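(* Let $\nu>-1$ and $r>0$. Put $\kappa_\nu=\frac{r^2}{4(\nu+1)(\nu+2)}$ and $\lambda_\nu=0$. Then for all real $x$ with $|x|<r$, $$\left(\frac{r^2-x^2}{r^2}\right)^{\kappa_{\nu}}\leq\frac{\mathcal{I}_{\nu+1}(x)}{\mathcal{I}_{\nu}(x)}\leq\left(\frac{r^2-x^2}{r^2}\right)^{\lambda_{\nu}}.$$ Moreover the constants are best possible: $\kappa_\nu$ is the smallest real exponent for which the left-hand inequality holds for all $|x|<r$, and $\lambda_\nu$ is the largest real exponent for which the right-hand inequality holds for all $|x|<r$. In particular (taking $\nu=-\frac12$ and $r=\frac{\pi}{2}$), for all real $x$ with $|x|<\frac{\pi}{2}$, $$\left(\frac{\pi^2-4x^2}{\pi^2}\right)^{\frac{\pi^2}{12}}\leq\frac{\tanh x}{x}\leq\left(\frac{\pi^2-4x^2}{\pi^2}\right)^{0},$$ where $\frac{\pi^2}{12}$ is the smallest real exponent for which the left-hand inequality, and $0$ the largest real exponent for which the right-hand inequality, holds for all $|x|<\frac{\pi}{2}$.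
   Context: For $\nu>-1$, $I_\nu$ is the modified Bessel function of the first kind, $I_\nu(x)=\sum_{n\ge0}\frac{1}{n!\,\Gamma(\nu+n+1)}\left(\frac{x}{2}\right)^{2n+\nu}$ for $x>0$. The normalized modified Bessel function is $\mathcal{I}_\nu(x)=\sum_{n\ge0}\frac{\Gamma(\nu+1)}{n!\,\Gamma(\nu+n+1)}\left(\frac{x}{2}\right)^{2n}$ for $x\in\mathbb{R}$; thus $\mathcal{I}_\nu(x)=2^\nu\Gamma(\nu+1)x^{-\nu}I_\nu(x)$ for $x>0$ and $\mathcal{I}_\nu(0)=1$. The function $\frac{\tanh x}{x}$ is understood to equal its limit $1$ at $x=0$. *)

(* Defs.v *)
From Stdlib Require Import Reals Factorial Lra.
From Coquelicot Require Import Coquelicot.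
Open Scope R_scope.

(* Euler's integral over (0, +oo), improper at both ends; it converges exactly
   when 0 < z, and [Gamma z] is meaningful only for such z.  Every argument
   below has the form nu + 1 or nu + n + 1 with -1 < nu. *)
Definition Gamma (z : R) : R :=
  RInt_gen (fun t => Rpower t (z - 1) * exp (- t))
           (at_right 0) (Rbar_locally p_infty).

(* Normalized modified Bessel function of the first kind, for -1 < nu;
   the series converges for every real x. *)
Definition normBesselI (nu x : R) : R :=
  Series (fun n : nat =>
    Gamma (nu + 1) / (INR (fact n) * Gamma (nu + INR n + 1)) * (x / 2) ^ (2 * n)).

(* tanh x / x, extended by its limit at 0. *)
Definition tanhc (x : R) : R :=
  if Req_dec_T x 0 then 1 else tanh x / x.

(* Main.v *)
Require Import Defs.
From Stdlib Require Import Reals Factorial Lra Lia.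
From Coquelicot Require Import Coquelicot.
Open Scope R_scope.

(** With [b = nu + 1], [t = x^2 / 4] and [c = 1 / (b (b + 1))], let
    [F_b t = sum t^n / (n! b (b + 1) ... (b + n - 1))], so that the ratio is
    [F_(b+1) / F_b].  Comparing coefficients gives
    [F_(b+1) + c t <= F_b <= (1 + c t) F_(b+1)].  As [kappa x^2 / r^2 = c t], the
    lower bound is the chain
    [(1 - x^2 / r^2)^kappa <= exp (- c t) <= 1 / (1 + c t) <= F_(b+1) / F_b].
    The exponent [kappa] is forced by the first-order behaviour at [x = 0], and
    [lambda = 0] by the ratio staying away from [0] as [|x|] tends to [r].  For
    [nu = -1/2] the even and odd parts of the exponential series identify the
    ratio with [tanh x / x]. *)

(** * The Gamma function *)

Lemma Rpower_pred (t z : R) : 0 < t -> Rpower t (z - 1) = Rpower t z / t.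
Proof.
  intros Ht. unfold Rminus. rewrite Rpower_plus, Rpower_Ropp, Rpower_1 by assumption.
  reflexivity.
Qed.

(** The inequality [1 + ln s <= s] at [s = t / (2 * z)], multiplied by [z], bounds [z * ln t] by
    [z * ln (2 * z) + t / 2]; hence [K] is [(2z)^z]. *)
Lemma Rpower_le_exp_half (z : R) :
  0 < z -> exists K, 0 < K /\ forall t, 0 < t -> Rpower t z <= K * exp (t / 2).
Proof.
  intros Hz. exists (exp (z * ln (2 * z))). split; [apply exp_pos|].
  intros t Ht. unfold Rpower. rewrite <- exp_plus.
  assert (Hln : 1 + ln (t / (2 * z)) <= t / (2 * z)).
  { rewrite <- (exp_ln (t / (2 * z))) at 2 by (apply Rdiv_lt_0_compat; lra).
    apply exp_ineq1_le. }
  rewrite ln_div in Hln by lra.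
  assert (H : z * (1 + (ln t - ln (2 * z))) <= z * (t / (2 * z)))
    by (apply Rmult_le_compat_l; lra).
  replace (z * (t / (2 * z))) with (t / 2) in H by (field; lra).
  destruct (Rle_lt_or_eq_dec (z * ln t) (z * ln (2 * z) + t / 2)) as [Hlt|Heq];
    [nra| |rewrite Heq; lra].
  left. now apply exp_increasing.
Qed.

Lemma continuous_gamma_integrand (z t : R) :
  0 < t -> continuous (fun s => Rpower s (z - 1) * exp (- s)) t.
Proof.
  intros Ht. apply (ex_derive_continuous (V := R_NormedModule)).
  unfold Rpower. auto_derive. assumption.
Qed.

Lemma ex_RInt_gamma_integrand (z a b : R) :
  0 < a -> a <= b -> ex_RInt (fun t => Rpower t (z - 1) * exp (- t)) a b.
Proof.
  intros Ha Hab. apply (ex_RInt_continuous (V := R_CompleteNormedModule)).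
  rewrite Rmin_left, Rmax_right by assumption.
  intros t Ht. apply continuous_gamma_integrand. lra.
Qed.

(* The integrand is dominated by a multiple of [t^(z-1) / (1 + t^z)^2], whose
   antiderivative [- 1 / (z (1 + t^z))] is bounded at both ends. *)
Lemma gamma_integral_bounded (z : R) :
  0 < z -> exists M, forall a b, 0 < a -> a <= b ->
    RInt (fun t => Rpower t (z - 1) * exp (- t)) a b <= M.
Proof.
  intros Hz. destruct (Rpower_le_exp_half z Hz) as [K [HK HKt]].
  set (C := (1 + K) ^ 2).
  exists (C / z). intros a b Ha Hab.
  set (g := fun t => C * Rpower t (z - 1) / (1 + Rpower t z) ^ 2).
  set (G := fun t => - (C / z) / (1 + Rpower t z)).
  assert (Hp : forall s, 0 < Rpower s z) by (intros; apply exp_pos).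
  assert (HG : is_RInt g a b (minus (G b) (G a))).
  { apply (is_RInt_derive (V := R_CompleteNormedModule) G g);
      rewrite Rmin_left, Rmax_right by assumption; intros t Ht.
    - unfold G, g. generalize (Hp t). intros Hpt.
      rewrite Rpower_pred by lra. unfold Rpower in *.
      auto_derive; [split; lra|]. field. lra.
    - apply (ex_derive_continuous (V := R_NormedModule)).
      generalize (Hp t). intros Hpt. unfold g, Rpower in *. auto_derive.
      repeat split; try lra; try nra. }
  apply Rle_trans with (minus (G b) (G a)).
  - apply (is_RInt_le (fun t => Rpower t (z - 1) * exp (- t)) g a b); try assumption.
    + apply (RInt_correct (V := R_CompleteNormedModule)).
      now apply ex_RInt_gamma_integrand.
    + intros t Ht. unfold g. rewrite Rmult_comm. unfold Rdiv.
      rewrite (Rmult_comm C), Rmult_assoc, (Rmult_comm (exp (- t))).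
      apply Rmult_le_compat_l; [left; apply exp_pos|].
      (* Both [1] and [t^z / K] are at most [exp (t / 2)]; squaring the sum gives
         [(1 + t^z)^2 <= C * exp t], which is the required domination of [exp (- t)]. *)
      assert (H1 : 1 + Rpower t z <= (1 + K) * exp (t / 2)).
      { generalize (HKt t ltac:(lra)) (exp_ineq1_le (t / 2)). nra. }
      assert (H2 : (1 + Rpower t z) ^ 2 <= C * exp t).
      { unfold C. replace t with (t / 2 + t / 2) at 2 by field. rewrite exp_plus.
        replace ((1 + K) ^ 2 * (exp (t / 2) * exp (t / 2)))
          with (((1 + K) * exp (t / 2)) ^ 2) by ring.
        apply pow_incr. generalize (Hp t). lra. }
      assert (H0 : 0 < (1 + Rpower t z) ^ 2) by (apply pow_lt; generalize (Hp t); lra).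
      apply Rmult_le_reg_r with ((1 + Rpower t z) ^ 2); [assumption|].
      rewrite Rmult_assoc, Rinv_l, Rmult_1_r by lra.
      apply Rmult_le_reg_l with (exp t); [apply exp_pos|].
      rewrite <- Rmult_assoc, <- exp_plus, Rplus_opp_r, exp_0. lra.
  - unfold minus, plus, opp, G; simpl.
    generalize (Hp a) (Hp b). intros Hpa Hpb.
    assert (HC : 0 < C / z) by (apply Rdiv_lt_0_compat; [unfold C; apply pow_lt|]; lra).
    assert (H1 : / (1 + Rpower a z) <= 1)
      by (rewrite <- Rinv_1 at 2; apply Rinv_le_contravar; lra).
    assert (H2 : 0 < / (1 + Rpower b z)) by (apply Rinv_0_lt_compat; lra).
    unfold Rdiv at 1 3. nra.
Qed.

(* The improper integral is the supremum of the proper ones. *)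
Lemma is_RInt_gen_of_bounded (f : R -> R) (M : R) :
  (forall a b, 0 < a -> a <= b -> ex_RInt f a b) ->
  (forall t, 0 < t -> 0 <= f t) ->
  (forall a b, 0 < a -> a <= b -> RInt f a b <= M) ->
  exists l, is_RInt_gen f (at_right 0) (Rbar_locally p_infty) l /\
    forall a b, 0 < a -> a <= b -> RInt f a b <= l.
Proof.
  intros Hex Hpos Hbd.
  set (E := fun v => exists a b, 0 < a /\ a <= b /\ v = RInt f a b).
  destruct (completeness E) as [l [Hub Hlub]].
  { exists M. intros v [a [b [Ha [Hab ->]]]]. now apply Hbd. }
  { exists (RInt f 1 1), 1, 1. lra. }
  assert (Hle : forall a b, 0 < a -> a <= b -> RInt f a b <= l).
  { intros a b Ha Hab. apply Hub. now exists a, b. }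
  exists l. split; [|exact Hle].
  intros P [eps HP].
  (* Otherwise [l - eps] would be a smaller upper bound of [E]. *)
  assert (Hne : exists a b, 0 < a /\ a <= b /\ l - eps < RInt f a b).
  { apply Classical_Prop.NNPP. intros Hno.
    assert (l <= l - eps); [|destruct eps; simpl in *; lra].
    apply Hlub. intros v [a [b [Ha [Hab ->]]]].
    apply Rnot_lt_le. intros Hlt. apply Hno. now exists a, b. }
  destruct Hne as [a0 [b0 [Ha0 [Hab0 Hl]]]].
  apply (Filter_prod _ _ _ (fun a => 0 < a < a0) (fun b => b0 < b)).
  - exists (mkposreal a0 Ha0). intros y Hy Hy0.
    unfold ball in Hy; simpl in Hy; unfold AbsRing_ball, abs, minus, plus, opp in Hy;
      simpl in Hy.
    apply Rabs_def2 in Hy. lra.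
  - now exists b0.
  - intros a b Ha Hb. simpl. exists (RInt f a b).
    split; [apply (RInt_correct (V := R_CompleteNormedModule)), Hex; lra|].
    apply HP. unfold ball; simpl; unfold AbsRing_ball, abs, minus, plus, opp; simpl.
    (* Enlarging [[a0, b0]] only adds nonnegative pieces, so the integral stays between [l - eps]
       and [l]. *)
    assert (H1 : RInt f a b = RInt f a a0 + RInt f a0 b0 + RInt f b0 b).
    { rewrite <- (RInt_Chasles f a b0 b), <- (RInt_Chasles f a a0 b0);
        try (apply Hex; lra). reflexivity. }
    assert (H2 : 0 <= RInt f a a0)
      by (apply RInt_ge_0; [lra|apply Hex; lra|intros; apply Hpos; lra]).
    assert (H3 : 0 <= RInt f b0 b)
      by (apply RInt_ge_0; [lra|apply Hex; lra|intros; apply Hpos; lra]).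
    generalize (Hle a b ltac:(lra) ltac:(lra)).
    destruct eps as [eps Heps]; simpl in *. intros H4.
    apply Rabs_def1; lra.
Qed.

Lemma Gamma_spec (z : R) : 0 < z ->
  is_RInt_gen (fun t => Rpower t (z - 1) * exp (- t))
    (at_right 0) (Rbar_locally p_infty) (Gamma z) /\ 0 < Gamma z.
Proof.
  intros Hz. destruct (gamma_integral_bounded z Hz) as [M HM].
  assert (Hpos : forall t, 0 < Rpower t (z - 1) * exp (- t))
    by (intros t; apply Rmult_lt_0_compat; apply exp_pos).
  destruct (is_RInt_gen_of_bounded (fun t => Rpower t (z - 1) * exp (- t)) M)
    as [l [Hl Hle]].
  - apply ex_RInt_gamma_integrand.
  - intros t _. left. apply Hpos.
  - exact HM.
  - assert (HG : Gamma z = l) by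
      exact (is_RInt_gen_unique (V := R_CompleteNormedModule) _ _ Hl).
    rewrite HG. split; [exact Hl|].
    (* Positivity: the supremum dominates the integral over [[1, 2]], whose integrand is positive
       and continuous. *)
    eapply Rlt_le_trans; [|apply (Hle 1 2); lra].
    apply RInt_gt_0; [lra|intros; apply Hpos|].
    intros t Ht. apply continuous_gamma_integrand. lra.
Qed.

(** * Integration by parts and the functional equation of Gamma *)

Lemma filterlim_gamma_boundary_0 (z : R) : 0 < z ->
  filterlim (fun t => Rpower t z * exp (- t)) (at_right 0) (locally 0).
Proof.
  intros Hz. apply filterlim_locally. intros [eps Heps].
  (* The radius is [eps^(1/z)], below which [t^z < eps]. *)
  assert (Hd : 0 < exp (ln eps / z)) by apply exp_pos.
  exists (mkposreal _ Hd). intros t Ht Ht0.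
  unfold ball in *; simpl in *; unfold AbsRing_ball, abs, minus, plus, opp in *;
    simpl in *.
  rewrite Ropp_0, Rplus_0_r, Rabs_pos_eq in * by
    (try apply Rmult_le_pos; left; try apply exp_pos; assumption).
  assert (H1 : Rpower t z < eps).
  { unfold Rpower. rewrite <- (exp_ln eps) by assumption. apply exp_increasing.
    apply ln_increasing in Ht; [|assumption]. rewrite ln_exp in Ht.
    apply (Rmult_lt_compat_l z) in Ht; [|assumption].
    replace (z * (ln eps / z)) with (ln eps) in Ht by (field; lra). exact Ht. }
  assert (H2 : exp (- t) < 1)
    by (rewrite <- exp_0; apply exp_increasing; lra).
  assert (H3 : 0 < Rpower t z) by apply exp_pos.
  nra.
Qed.

Lemma filterlim_gamma_boundary_infty (z : R) : 0 < z ->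
  filterlim (fun t => Rpower t z * exp (- t)) (Rbar_locally p_infty) (locally 0).
Proof.
  intros Hz. destruct (Rpower_le_exp_half z Hz) as [K [HK HKt]].
  apply filterlim_locally. intros [eps Heps].
  (* The function is at most [K * exp (- (t / 2)) <= K / (1 + t / 2)], which is below [eps] once
     [t > 2 * K / eps]. *)
  exists (Rmax 0 (2 * K / eps)). intros t Ht.
  assert (Ht0 : 0 < t) by (eapply Rle_lt_trans; [apply Rmax_l|exact Ht]).
  assert (Ht1 : 2 * K / eps < t) by (eapply Rle_lt_trans; [apply Rmax_r|exact Ht]).
  unfold ball; simpl; unfold AbsRing_ball, abs, minus, plus, opp; simpl.
  rewrite Ropp_0, Rplus_0_r, Rabs_pos_eq by
    (apply Rmult_le_pos; left; apply exp_pos).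
  apply Rmult_lt_reg_r with (exp t); [apply exp_pos|].
  rewrite Rmult_assoc, <- exp_plus, Rplus_opp_l, exp_0, Rmult_1_r.
  eapply Rle_lt_trans; [now apply HKt|].
  replace t with (t / 2 + t / 2) at 2 by field. rewrite exp_plus, <- Rmult_assoc.
  apply Rmult_lt_compat_r; [apply exp_pos|].
  apply Rlt_le_trans with (eps * (1 + t / 2));
    [|apply Rmult_le_compat_l; [lra|apply exp_ineq1_le]].
  apply (Rmult_lt_compat_l eps) in Ht1; [|assumption].
  replace (eps * (2 * K / eps)) with (2 * K) in Ht1 by (field; lra). nra.
Qed.

(** Both endpoints are eventually positive, hence so is every point between them. This turns
    pointwise facts on the positive half-line into the side conditions of improper integration. *)
Lemma filter_prod_pos_interval (P : R -> Prop) :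
  (forall x, 0 < x -> P x) ->
  filter_prod (at_right 0) (Rbar_locally p_infty)
    (fun ab => forall x, Rmin (fst ab) (snd ab) <= x <= Rmax (fst ab) (snd ab) -> P x).
Proof.
  intros HP. apply (Filter_prod _ _ _ (fun a => 0 < a) (fun b => 0 < b)).
  - exists (mkposreal 1 Rlt_0_1). intros y _ Hy. exact Hy.
  - exists 0. intros y Hy; exact Hy.
  - intros a b Ha Hb x [Hx _]. apply HP. simpl in Hx.
    eapply Rlt_le_trans; [|exact Hx]. now apply Rmin_glb_lt.
Qed.

(** Integration by parts: [h t = t^z * exp (- t)] vanishes at both ends, so its derivative [dh] has
    integral [0], and the integrand for [z + 1] is [z] times the one for [z] minus [dh]. *)
Lemma Gamma_succ (z : R) : 0 < z -> Gamma (z + 1) = z * Gamma z.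
Proof.
  intros Hz.
  destruct (Gamma_spec z Hz) as [Hint _].
  set (h := fun t => Rpower t z * exp (- t)).
  set (dh := fun t => z * (Rpower t (z - 1) * exp (- t)) - Rpower t z * exp (- t)).
  assert (Hder : forall t, 0 < t -> is_derive h t (dh t)).
  { intros t Ht. unfold h, dh. rewrite Rpower_pred by assumption. unfold Rpower.
    auto_derive; [assumption|]. field. lra. }
  assert (Hzero : is_RInt_gen (Derive h) (at_right 0) (Rbar_locally p_infty) (0 - 0)).
  { apply is_RInt_gen_Derive; try apply filter_prod_pos_interval.
    - intros x Hx. eexists. now apply Hder.
    - intros x Hx. apply (continuous_ext_loc (Derive h) dh x).
      + exists (mkposreal x Hx). intros y Hy.
        unfold ball in Hy; simpl in Hy; unfold AbsRing_ball, abs, minus, plus, opp in Hy;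
          simpl in Hy. apply Rabs_def2 in Hy.
        symmetry. apply is_derive_unique, Hder. lra.
      + apply (ex_derive_continuous (V := R_NormedModule)).
        unfold dh, Rpower. auto_derive. lra.
    - now apply filterlim_gamma_boundary_0.
    - now apply filterlim_gamma_boundary_infty. }
  apply (is_RInt_gen_scal _ z) in Hint.
  generalize (is_RInt_gen_minus _ _ _ _ Hint Hzero). intros H.
  unfold Gamma at 1.
  replace (z * Gamma z) with (minus (scal z (Gamma z)) (0 - 0))
    by (unfold minus, plus, opp, scal; simpl; unfold mult; simpl; ring).
  apply (is_RInt_gen_unique (V := R_CompleteNormedModule)).
  eapply is_RInt_gen_ext; [|exact H].
  eapply filter_imp; [|apply (filter_prod_pos_interval
    (fun x => minus (scal z (Rpower x (z - 1) * exp (- x))) (Derive h x) =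
              Rpower x (z + 1 - 1) * exp (- x)))].
  - intros ab Hab x Hx. apply Hab. lra.
  - intros x Hx. rewrite (is_derive_unique _ _ _ (Hder x Hx)).
    replace (z + 1 - 1) with z by ring.
    unfold dh, minus, plus, opp, scal; simpl; unfold mult; simpl. ring.
Qed.

(** * The Bessel series *)

(* [besselCoef b n = 1 / (n! b (b + 1) ... (b + n - 1))], so that
   [normBesselI nu x = PSeries (besselCoef (nu + 1)) ((x / 2) ^ 2)]. *)
Fixpoint besselCoef (b : R) (n : nat) : R :=
  match n with
  | O => 1
  | S m => besselCoef b m / (INR (S m) * (b + INR m))
  end.

Lemma besselCoef_S (b : R) (n : nat) :
  besselCoef b (S n) = besselCoef b n / (INR (S n) * (b + INR n)).
Proof. reflexivity. Qed.

Lemma besselCoef_pos (b : R) (n : nat) : 0 < b -> 0 < besselCoef b n.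
Proof.
  intros Hb. induction n as [|n IH]; [simpl; lra|].
  rewrite besselCoef_S. apply Rdiv_lt_0_compat; [assumption|].
  generalize (pos_INR n). rewrite S_INR. intros. apply Rmult_lt_0_compat; lra.
Qed.

(** Each factor [b + m] is at least [b]. The comparison series is that of [exp (t / b)], which
    yields both convergence and an upper bound for the sum. *)
Lemma besselCoef_le_exp (b : R) (n : nat) :
  0 < b -> besselCoef b n <= / INR (fact n) * (/ b) ^ n.
Proof.
  intros Hb. induction n as [|n IH]; [simpl; lra|].
  rewrite besselCoef_S, fact_simpl, mult_INR.
  generalize (pos_INR n) (S_INR n) (besselCoef_pos b n Hb) (INR_fact_lt_0 n).
  intros Hn HS Hw Hf.
  assert (HS0 : 0 < INR (S n)) by lra.
  replace (/ (INR (S n) * INR (fact n)) * (/ b) ^ S n)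
    with (/ INR (fact n) * (/ b) ^ n * / (INR (S n) * b)) by (simpl pow; field; lra).
  apply Rmult_le_compat; [lra| |assumption|].
  - left. apply Rinv_0_lt_compat. apply Rmult_lt_0_compat; lra.
  - apply Rinv_le_contravar; [apply Rmult_lt_0_compat; lra|].
    apply Rmult_le_compat_l; lra.
Qed.

(** The products [b (b + 1) ... (b + n - 1)] and [(b + 1) ... (b + n)] differ only in their end
    factors [b] and [b + n]. *)
Lemma besselCoef_shift (b : R) (n : nat) :
  0 < b -> besselCoef b n = besselCoef (b + 1) n * ((b + INR n) / b).
Proof.
  intros Hb. induction n as [|n IH]; [simpl; field; lra|].
  rewrite 2!besselCoef_S, IH. generalize (pos_INR n). rewrite S_INR. intros.
  field. lra.
Qed.

(** By the shift, the difference is [besselCoef (b + 1) (S n)] times [(n + 1) / b], and the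
    recursion cancels [n + 1]. The two-sided comparison of the series rests on this identity. *)
Lemma besselCoef_diff (b : R) (n : nat) :
  0 < b ->
  besselCoef b (S n) - besselCoef (b + 1) (S n)
    = besselCoef (b + 1) n / (b * (b + 1 + INR n)).
Proof.
  intros Hb. rewrite (besselCoef_shift b (S n)) by assumption.
  rewrite besselCoef_S. generalize (pos_INR n). rewrite S_INR. intros.
  field. lra.
Qed.

Lemma ex_pseries_besselCoef (b t : R) :
  0 < b -> 0 <= t -> ex_series (fun n => besselCoef b n * t ^ n).
Proof.
  intros Hb Ht.
  apply (ex_series_le (K := R_AbsRing) (V := R_CompleteNormedModule) _
    (fun n => / INR (fact n) * (t / b) ^ n)).
  - intros n. unfold norm; simpl; unfold abs; simpl.
    rewrite Rabs_pos_eq by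
      (apply Rmult_le_pos; [left; now apply besselCoef_pos|now apply pow_le]).
    unfold Rdiv. rewrite Rpow_mult_distr, (Rmult_comm (t ^ n)), <- Rmult_assoc.
    apply Rmult_le_compat_r; [now apply pow_le|now apply besselCoef_le_exp].
  - apply (ex_pseries_R (fun n => / INR (fact n)) (t / b)).
    eexists. apply is_exp_Reals.
Qed.

Lemma PSeries_besselCoef_le_exp (b t : R) :
  0 < b -> 0 <= t -> PSeries (besselCoef b) t <= exp (t / b).
Proof.
  intros Hb Ht. rewrite exp_Reals. apply Series_le.
  - intros n. split;
      [apply Rmult_le_pos; [left; now apply besselCoef_pos|now apply pow_le]|].
    unfold Rdiv. rewrite Rpow_mult_distr, (Rmult_comm (t ^ n)), <- Rmult_assoc.
    apply Rmult_le_compat_r; [now apply pow_le|now apply besselCoef_le_exp].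
  - apply (ex_pseries_R (fun n => / INR (fact n)) (t / b)).
    eexists. apply is_exp_Reals.
Qed.

Lemma Series_ge_head (a : nat -> R) :
  (forall n, 0 <= a n) -> ex_series a -> a 0%nat <= Series a.
Proof.
  intros Hpos Hex. rewrite Series_incr_1 by assumption.
  assert (0 <= Series (fun k => a (S k))); [|lra].
  replace 0 with (Series (fun k => 0 * a (S k))).
  - apply Series_le; [intros n; generalize (Hpos (S n)); lra|].
    now apply (ex_series_incr_1 (V := R_NormedModule)) in Hex.
  - rewrite Series_scal_l. ring.
Qed.

Lemma PSeries_besselCoef_ge_1 (b t : R) :
  0 < b -> 0 <= t -> 1 <= PSeries (besselCoef b) t.
Proof.
  intros Hb Ht.
  replace 1 with (besselCoef b 0 * t ^ 0) by (simpl; ring).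
  apply (Series_ge_head (fun n => besselCoef b n * t ^ n)).
  - intros n. apply Rmult_le_pos; [left; now apply besselCoef_pos|now apply pow_le].
  - now apply ex_pseries_besselCoef.
Qed.

(** The constant terms cancel, so a factor [t] comes out and the index moves by one. *)
Lemma PSeries_besselCoef_diff (b t : R) :
  0 < b -> 0 <= t ->
  ex_series (fun n => besselCoef (b + 1) n / (b * (b + 1 + INR n)) * t ^ n) /\
  PSeries (besselCoef b) t - PSeries (besselCoef (b + 1)) t =
    t * Series (fun n => besselCoef (b + 1) n / (b * (b + 1 + INR n)) * t ^ n).
Proof.
  intros Hb Ht. assert (Hb1 : 0 < b + 1) by lra. split.
  - apply (ex_series_le (K := R_AbsRing) (V := R_CompleteNormedModule) _
      (fun n => / (b * (b + 1)) * (besselCoef (b + 1) n * t ^ n))).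
    + intros n. unfold norm; simpl; unfold abs; simpl.
      generalize (besselCoef_pos (b + 1) n Hb1) (pow_le t n Ht) (pos_INR n).
      intros Hw Hp Hn.
      assert (H : 0 < b * (b + 1 + INR n)) by (apply Rmult_lt_0_compat; lra).
      unfold Rdiv. rewrite Rabs_pos_eq.
      * rewrite (Rmult_comm (besselCoef _ _)), Rmult_assoc.
        apply Rmult_le_compat_r; [apply Rmult_le_pos; lra|].
        apply Rinv_le_contravar; [apply Rmult_lt_0_compat; lra|].
        apply Rmult_le_compat_l; lra.
      * apply Rmult_le_pos; [left; apply Rdiv_lt_0_compat|]; assumption.
    + apply (ex_series_scal (K := R_AbsRing) (V := R_NormedModule)).
      now apply ex_pseries_besselCoef.
  - unfold PSeries.
    rewrite <- Series_minus by now apply ex_pseries_besselCoef.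
    rewrite Series_incr_1, <- Series_scal_l
      by (apply (ex_series_minus (V := R_NormedModule));
          now apply ex_pseries_besselCoef).
    simpl pow at 1 2. simpl besselCoef at 1 2.
    rewrite Rminus_diag, Rplus_0_l. apply Series_ext. intros n.
    rewrite <- Rmult_minus_distr_r, besselCoef_diff by assumption.
    simpl pow. ring.
Qed.

(** All terms of the difference series are nonnegative; only the term [n = 0] is kept. *)
Lemma PSeries_besselCoef_diff_ge (b t : R) :
  0 < b -> 0 <= t ->
  t / (b * (b + 1)) <= PSeries (besselCoef b) t - PSeries (besselCoef (b + 1)) t.
Proof.
  intros Hb Ht. destruct (PSeries_besselCoef_diff b t Hb Ht) as [Hex ->].
  apply Rmult_le_compat_l; [assumption|].
  eapply Rle_trans; [|apply Series_ge_head; [|exact Hex]].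
  - simpl. right. field. lra.
  - intros n. generalize (besselCoef_pos (b + 1) n ltac:(lra)) (pos_INR n). intros.
    apply Rmult_le_pos; [|now apply pow_le].
    left. apply Rdiv_lt_0_compat; [assumption|apply Rmult_lt_0_compat; lra].
Qed.

(** Termwise, [b + 1 + n] is replaced by the smaller [b + 1] in the denominator. *)
Lemma PSeries_besselCoef_diff_le (b t : R) :
  0 < b -> 0 <= t ->
  PSeries (besselCoef b) t - PSeries (besselCoef (b + 1)) t
    <= t / (b * (b + 1)) * PSeries (besselCoef (b + 1)) t.
Proof.
  intros Hb Ht. destruct (PSeries_besselCoef_diff b t Hb Ht) as [_ ->].
  unfold Rdiv. rewrite Rmult_assoc. apply Rmult_le_compat_l; [assumption|].
  unfold PSeries. rewrite <- Series_scal_l. apply Series_le.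
  - intros n. assert (Hb1 : 0 < b + 1) by lra.
    generalize (besselCoef_pos (b + 1) n Hb1) (pow_le t n Ht) (pos_INR n).
    intros Hw Hp Hn.
    assert (H : 0 < b * (b + 1 + INR n)) by (apply Rmult_lt_0_compat; lra).
    split; [apply Rmult_le_pos; [left; apply Rdiv_lt_0_compat|]; assumption|].
    rewrite (Rmult_comm (besselCoef _ _)), Rmult_assoc.
    apply Rmult_le_compat_r; [apply Rmult_le_pos; lra|].
    apply Rinv_le_contravar; [apply Rmult_lt_0_compat; lra|].
    apply Rmult_le_compat_l; lra.
  - apply (ex_series_scal (K := R_AbsRing) (V := R_NormedModule)).
    apply ex_pseries_besselCoef; lra.
Qed.

(** * From Gamma quotients to bounds on the Bessel ratio *)

Lemma Gamma_ratio (b : R) (n : nat) : 0 < b ->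
  Gamma b / (INR (fact n) * Gamma (b + INR n)) = besselCoef b n.
Proof.
  intros Hb. induction n as [|n IH].
  - simpl. rewrite Rplus_0_r. destruct (Gamma_spec b Hb). field. lra.
  - rewrite besselCoef_S, <- IH, fact_simpl, mult_INR.
    generalize (pos_INR n) (INR_fact_lt_0 n) (S_INR n). intros Hn Hf HS.
    destruct (Gamma_spec (b + INR n) ltac:(lra)) as [_ HG].
    replace (b + INR (S n)) with (b + INR n + 1) by (rewrite S_INR; ring).
    rewrite (Gamma_succ (b + INR n)) by lra. field. lra.
Qed.

Lemma normBesselI_PSeries (nu x : R) : -1 < nu ->
  normBesselI nu x = PSeries (besselCoef (nu + 1)) ((x / 2) ^ 2).
Proof.
  intros Hnu. apply Series_ext. intros n.
  rewrite <- Gamma_ratio by lra. rewrite pow_mult.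
  now replace (nu + INR n + 1) with (nu + 1 + INR n) by ring.
Qed.

(** With [f = F_b t] and [g = F_(b+1) t], the first two bounds come from [f <= (1 + c t) g] and
    [g <= f]. The last, from [g <= f - c t] and [f <= exp (t / b)], has the first-order precision at
    [0] that the optimality of [kappa] needs. *)
Lemma normBesselI_ratio_bounds (nu x : R) : -1 < nu ->
  let c := / ((nu + 1) * (nu + 2)) in
  let t := (x / 2) ^ 2 in
  / (1 + c * t) <= normBesselI (nu + 1) x / normBesselI nu x <= 1 /\
  normBesselI (nu + 1) x / normBesselI nu x <= 1 - c * t * exp (- (t / (nu + 1))).
Proof.
  intros Hnu c t. rewrite 2!normBesselI_PSeries by lra. fold t.
  set (b := nu + 1) in *. assert (Hb : 0 < b) by (unfold b; lra).
  assert (Ht : 0 <= t) by (unfold t; nra).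
  assert (Hcb : c = / (b * (b + 1)))
    by (unfold c, b; f_equal; ring).
  clearbody c. assert (Hc : 0 < c)
    by (rewrite Hcb; apply Rinv_0_lt_compat, Rmult_lt_0_compat; lra).
  generalize (PSeries_besselCoef_diff_ge b t Hb Ht)
    (PSeries_besselCoef_diff_le b t Hb Ht) (PSeries_besselCoef_le_exp b t Hb Ht)
    (PSeries_besselCoef_ge_1 b t Hb Ht) (PSeries_besselCoef_ge_1 (b + 1) t ltac:(lra) Ht).
  replace (t / (b * (b + 1))) with (c * t) by (rewrite Hcb; field; lra).
  set (f := PSeries (besselCoef b) t). set (g := PSeries (besselCoef (b + 1)) t).
  intros H1 H2 H3 Hf Hg.
  assert (Hct : 0 <= c * t) by nra.
  split; [split|].
  - apply Rmult_le_reg_l with ((1 + c * t) * f); [nra|].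
    replace ((1 + c * t) * f * / (1 + c * t)) with f by (field; lra).
    replace ((1 + c * t) * f * (g / f)) with ((1 + c * t) * g) by (field; lra). lra.
  - apply Rmult_le_reg_r with f; [lra|].
    unfold Rdiv. rewrite Rmult_assoc, Rinv_l by lra. lra.
  - apply Rmult_le_reg_r with f; [lra|].
    unfold Rdiv. rewrite Rmult_assoc, Rinv_l by lra.
    assert (H4 : exp (- (t / b)) * f <= 1).
    { rewrite <- exp_0, <- (Rplus_opp_l (t / b)), exp_plus.
      apply Rmult_le_compat_l; [left; apply exp_pos|exact H3]. }
    fold (t / b). nra.
Qed.

(** * The bounds and their sharpness *)

(** The coefficients for [1 / 2] and [3 / 2] are [4^n / (2n)!] and [4^n / (2n + 1)!], so the two
    series are [cosh x] and, for nonzero [x], [sinh x / x]. *)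
Lemma PSeries_exp_even_odd (x : R) :
  exp x = PSeries (besselCoef (1 / 2)) ((x / 2) ^ 2)
          + x * PSeries (besselCoef (3 / 2)) ((x / 2) ^ 2).
Proof.
  assert (Hcoef : forall n,
    besselCoef (1 / 2) n = 4 ^ n / INR (fact (2 * n)) /\
    besselCoef (3 / 2) n = 4 ^ n / INR (fact (2 * n + 1))).
  { intros n.
    assert (Heven : besselCoef (1 / 2) n = 4 ^ n / INR (fact (2 * n))).
    { induction n as [|n IH]; [simpl; field|].
      rewrite besselCoef_S, IH. replace (2 * S n)%nat with (S (S (2 * n))) by lia.
      rewrite 2!fact_simpl, 2!mult_INR, !S_INR, mult_INR.
      generalize (pos_INR n) (INR_fact_lt_0 (2 * n)). simpl (INR 2). simpl pow.
      intros. field. repeat split; lra. }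
    split; [assumption|].
    generalize (besselCoef_shift (1 / 2) n ltac:(lra)). rewrite Heven.
    replace (1 / 2 + 1) with (3 / 2) by field.
    replace (2 * n + 1)%nat with (S (2 * n)) by lia.
    rewrite fact_simpl, mult_INR, S_INR, mult_INR. simpl (INR 2).
    generalize (pos_INR n) (INR_fact_lt_0 (2 * n)). intros Hn Hf H.
    apply Rmult_eq_reg_r with ((1 / 2 + INR n) / (1 / 2));
      [|apply Rgt_not_eq, Rdiv_lt_0_compat; lra].
    rewrite <- H. field. lra. }
  assert (Hev : forall n, besselCoef (1 / 2) n * ((x / 2) ^ 2) ^ n =
    / INR (fact (2 * n)) * (x ^ 2) ^ n).
  { intros n. rewrite (proj1 (Hcoef n)).
    replace (x ^ 2) with (4 * (x / 2) ^ 2) by field.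
    rewrite (Rpow_mult_distr 4). unfold Rdiv. ring. }
  assert (Hod : forall n, besselCoef (3 / 2) n * ((x / 2) ^ 2) ^ n =
    / INR (fact (2 * n + 1)) * (x ^ 2) ^ n).
  { intros n. rewrite (proj2 (Hcoef n)).
    replace (x ^ 2) with (4 * (x / 2) ^ 2) by field.
    rewrite (Rpow_mult_distr 4). unfold Rdiv. ring. }
  rewrite exp_Reals, PSeries_odd_even.
  - unfold PSeries. f_equal; [|f_equal]; apply Series_ext; intros n; symmetry; auto.
  - apply ex_pseries_R. eapply ex_series_ext; [exact Hev|].
    apply ex_pseries_besselCoef; [lra|nra].
  - apply ex_pseries_R. eapply ex_series_ext; [exact Hod|].
    apply ex_pseries_besselCoef; [lra|nra].
Qed.

(** The series depend on [x] only through its square, so the splittings of [exp x] and [exp (- x)]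
    together give [cosh] and [sinh]; at [x = 0] both series equal [1]. *)
Lemma tanhc_normBesselI (x : R) :
  tanhc x = normBesselI (- (1 / 2) + 1) x / normBesselI (- (1 / 2)) x.
Proof.
  rewrite 2!normBesselI_PSeries by lra.
  replace (- (1 / 2) + 1 + 1) with (3 / 2) by field.
  replace (- (1 / 2) + 1) with (1 / 2) by field.
  generalize (PSeries_exp_even_odd x) (PSeries_exp_even_odd (- x)).
  replace ((- x / 2) ^ 2) with ((x / 2) ^ 2) by field.
  generalize (PSeries_besselCoef_ge_1 (1 / 2) ((x / 2) ^ 2) ltac:(lra) ltac:(nra)).
  intros Hpos Hx Hmx. unfold tanhc. destruct (Req_dec_T x 0) as [->|Hx0].
  - unfold PSeries. replace ((0 / 2) ^ 2) with 0 by (simpl; field).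
    assert (H0 : forall b, PSeries (besselCoef b) 0 = 1)
      by (intros; rewrite PSeries_0; reflexivity).
    fold (PSeries (besselCoef (1 / 2)) 0) (PSeries (besselCoef (3 / 2)) 0).
    rewrite 2!H0. field.
  - unfold tanh, sinh, cosh. rewrite Hx, Hmx. field. lra.
Qed.

(** * Power bounds and optimal exponents *)

Lemma Rpower_le_exp (y k : R) : 0 < y -> 0 <= k -> Rpower y k <= exp (k * (y - 1)).
Proof.
  intros Hy Hk. unfold Rpower.
  generalize (exp_ineq1_le (ln y)). rewrite exp_ln by assumption. intros Hln.
  assert (H : k * ln y <= k * (y - 1)) by (apply Rmult_le_compat_l; lra).
  destruct (Rle_lt_or_eq_dec _ _ H) as [Hlt| ->]; [|lra].
  left. now apply exp_increasing.
Qed.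

Lemma ratio_pow_lower (nu r x : R) : -1 < nu -> 0 < r -> Rabs x < r ->
  Rpower ((r ^ 2 - x ^ 2) / r ^ 2) (r ^ 2 / (4 * (nu + 1) * (nu + 2)))
    <= normBesselI (nu + 1) x / normBesselI nu x.
Proof.
  intros Hnu Hr Hx.
  destruct (normBesselI_ratio_bounds nu x Hnu) as [[Hlow _] _].
  eapply Rle_trans; [|exact Hlow]. clear Hlow.
  assert (H12 : 0 < (nu + 1) * (nu + 2)) by (apply Rmult_lt_0_compat; lra).
  assert (Hr2 : 0 < r ^ 2) by (apply pow_lt; lra).
  assert (Hxr : x ^ 2 < r ^ 2).
  { rewrite <- pow2_abs. generalize (Rabs_pos x). intros. nra. }
  eapply Rle_trans.
  - apply Rpower_le_exp; [apply Rdiv_lt_0_compat; lra|].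
    left. apply Rdiv_lt_0_compat; lra.
  - set (s := / ((nu + 1) * (nu + 2)) * (x / 2) ^ 2).
    replace (r ^ 2 / (4 * (nu + 1) * (nu + 2)) * ((r ^ 2 - x ^ 2) / r ^ 2 - 1))
      with (- s) by (unfold s; field; repeat split; lra).
    rewrite exp_Ropp. apply Rinv_le_contravar; [|apply exp_ineq1_le].
    assert (0 <= s); [|lra].
    unfold s. apply Rmult_le_pos; [left; now apply Rinv_0_lt_compat|nra].
Qed.

(** Lets the sharpness arguments run over [u = x^2 / r^2], for which the base of the powers is
    [1 - u]. *)
Lemma ex_square_fraction (r u : R) : 0 < r -> 0 <= u < 1 ->
  exists x, Rabs x < r /\ x ^ 2 = r ^ 2 * u /\ (r ^ 2 - x ^ 2) / r ^ 2 = 1 - u.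
Proof.
  intros Hr Hu. exists (r * sqrt u).
  assert (Hs : (r * sqrt u) ^ 2 = r ^ 2 * u)
    by (rewrite Rpow_mult_distr, pow2_sqrt by lra; reflexivity).
  split; [|split; [exact Hs|rewrite Hs; field; lra]].
  rewrite Rabs_pos_eq by (apply Rmult_le_pos; [lra|apply sqrt_pos]).
  rewrite <- (Rmult_1_r r) at 2. apply Rmult_lt_compat_l; [assumption|].
  rewrite <- sqrt_1. apply sqrt_lt_1; lra.
Qed.

Lemma ratio_pow_lower_sharp (nu r k : R) : -1 < nu -> 0 < r ->
  (forall x, Rabs x < r -> Rpower ((r ^ 2 - x ^ 2) / r ^ 2) k
     <= normBesselI (nu + 1) x / normBesselI nu x) ->
  r ^ 2 / (4 * (nu + 1) * (nu + 2)) <= k.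
Proof.
  intros Hnu Hr Hk.
  assert (Hr2 : 0 < r ^ 2) by (apply pow_lt; lra).
  set (K := r ^ 2 / (4 * (nu + 1) * (nu + 2))).
  assert (HK : 0 < K).
  { apply Rdiv_lt_0_compat; [assumption|].
    apply Rmult_lt_0_compat; [apply Rmult_lt_0_compat|]; lra. }
  set (q := r ^ 2 / (4 * (nu + 1))).
  assert (Hq : 0 < q) by (apply Rdiv_lt_0_compat; lra).
  (* First-order comparison of both sides at [u = x^2 / r^2 -> 0]. *)
  assert (Hu : forall u, 0 < u < 1 -> K * (1 - u) * (1 - q * u) <= k).
  { intros u Hu. destruct (ex_square_fraction r u Hr ltac:(lra)) as [x [Hx [Hx2 Hb]]].
    generalize (Hk x Hx). rewrite Hb. intros Hle.
    destruct (normBesselI_ratio_bounds nu x Hnu) as [_ Hup].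
    replace (/ ((nu + 1) * (nu + 2)) * (x / 2) ^ 2) with (K * u) in Hup
      by (replace ((x / 2) ^ 2) with (x ^ 2 / 4) by field; rewrite Hx2;
          unfold K; field; lra).
    replace ((x / 2) ^ 2 / (nu + 1)) with (q * u) in Hup
      by (replace ((x / 2) ^ 2) with (x ^ 2 / 4) by field; rewrite Hx2;
          unfold q; field; lra).
    unfold Rpower in Hle. generalize (exp_ineq1_le (k * ln (1 - u))). intros Hexp.
    (* Combines [1 + k * ln (1 - u) <= (1 - u)^k] with the upper bound on the ratio; since
       [ln (1 - u) < 0], it forces [k > 0]. *)
    assert (H1 : k * ln (1 - u) <= - (K * u * exp (- (q * u)))) by lra.
    assert (HKu : 0 < K * u) by (apply Rmult_lt_0_compat; lra).
    generalize (exp_pos (- (q * u))) (exp_ineq1_le (- (q * u))). intros He He1.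
    assert (Hneg : ln (1 - u) < 0).
    { rewrite <- ln_1. apply ln_increasing; lra. }
    assert (Hk0 : 0 < k) by nra.
    (* This is [1 + s <= exp s] at [s = - ln (1 - u)], multiplied by [1 - u]. *)
    assert (Hln : - ln (1 - u) * (1 - u) <= u).
    { generalize (exp_ineq1_le (- ln (1 - u))).
      rewrite exp_Ropp, exp_ln by lra. intros H.
      apply (Rmult_le_compat_r (1 - u)) in H; [|lra].
      rewrite Rinv_l in H by lra. lra. }
    apply Rmult_le_reg_l with u; [lra|].
    apply Rle_trans with (K * u * exp (- (q * u)) * (1 - u)).
    - replace (u * (K * (1 - u) * (1 - q * u)))
        with (K * u * (1 - u) * (1 - q * u)) by ring.
      replace (K * u * exp (- (q * u)) * (1 - u))
        with (K * u * (1 - u) * exp (- (q * u))) by ring.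
      apply Rmult_le_compat_l; [apply Rmult_le_pos|]; lra.
    - apply Rle_trans with (k * (- ln (1 - u) * (1 - u))).
      + replace (k * (- ln (1 - u) * (1 - u))) with (- (k * ln (1 - u)) * (1 - u)) by ring.
        apply Rmult_le_compat_r; lra.
      + rewrite (Rmult_comm u). apply Rmult_le_compat_l; lra. }
  apply Rnot_lt_le. intros Hlt.
  assert (Hd : 0 < 2 * K * (1 + q)) by (apply Rmult_lt_0_compat; lra).
  (* Since [K (1 - u) (1 - q u) >= K - K (1 + q) u], this [u] makes the left side at least
     [(K + k) / 2 > k]; the cap [1 / 2] keeps [u < 1]. *)
  set (u := Rmin (1 / 2) ((K - k) / (2 * K * (1 + q)))).
  assert (Hu1 : 0 < u) by (apply Rmin_glb_lt; [|apply Rdiv_lt_0_compat]; lra).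
  assert (Hu2 : u <= 1 / 2) by apply Rmin_l.
  assert (Hu3 : u * (2 * K * (1 + q)) <= K - k).
  { replace (K - k) with ((K - k) / (2 * K * (1 + q)) * (2 * K * (1 + q)))
      by (field; lra).
    apply Rmult_le_compat_r; [lra|apply Rmin_r]. }
  generalize (Hu u ltac:(lra)). intros H.
  assert (0 <= K * q * u * u) by (repeat first [lra | apply Rmult_le_pos]).
  nra.
Qed.

Lemma ratio_pow_upper_sharp (nu r l : R) : -1 < nu -> 0 < r ->
  (forall x, Rabs x < r -> normBesselI (nu + 1) x / normBesselI nu x
     <= Rpower ((r ^ 2 - x ^ 2) / r ^ 2) l) ->
  l <= 0.
Proof.
  intros Hnu Hr Hl. apply Rnot_lt_le. intros Hl0.
  assert (Hr2 : 0 < r ^ 2) by (apply pow_lt; lra).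
  set (K := r ^ 2 / (4 * (nu + 1) * (nu + 2))).
  assert (HK : 0 < K).
  { apply Rdiv_lt_0_compat; [assumption|].
    apply Rmult_lt_0_compat; [apply Rmult_lt_0_compat|]; lra. }
  (* The ratio stays above [1 / (1 + K)] while the right-hand side vanishes as
     [|x|] tends to [r]; the point where the base is [exp (- M)] is close enough. *)
  set (M := (K + 1) / l).
  assert (HM : 0 < M) by (apply Rdiv_lt_0_compat; lra).
  assert (HeM : exp (- M) < 1) by (rewrite <- exp_0; apply exp_increasing; lra).
  generalize (exp_pos (- M)). intros HeM0.
  destruct (ex_square_fraction r (1 - exp (- M)) Hr ltac:(lra)) as [x [Hx [Hx2 Hb]]].
  generalize (Hl x Hx). rewrite Hb.
  replace (1 - (1 - exp (- M))) with (exp (- M)) by ring.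
  unfold Rpower. rewrite ln_exp. intros Hle.
  destruct (normBesselI_ratio_bounds nu x Hnu) as [[Hlow _] _].
  replace (/ ((nu + 1) * (nu + 2)) * (x / 2) ^ 2)
    with (K * (1 - exp (- M))) in Hlow
    by (replace ((x / 2) ^ 2) with (x ^ 2 / 4) by field; rewrite Hx2;
        unfold K; field; lra).
  assert (Hu : 0 < K * (1 - exp (- M)) <= K) by (split; nra).
  assert (H : / (1 + K) <= exp (l * - M)).
  { eapply Rle_trans; [|eapply Rle_trans; [exact Hlow|exact Hle]].
    apply Rinv_le_contravar; lra. }
  (* As [l * M = K + 1], inverting [H] gives [exp (K + 1) <= 1 + K], contrary to
     [exp (K + 1) >= K + 2]. *)
  rewrite Ropp_mult_distr_r_reverse, exp_Ropp in H.
  replace (l * M) with (K + 1) in H by (unfold M; field; lra).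
  apply Rinv_le_contravar in H; [|apply Rinv_0_lt_compat; lra].
  rewrite 2!Rinv_inv in H.
  generalize (exp_ineq1_le (K + 1)). lra.
Qed.

Theorem theorem5 :
  (forall nu r : R, -1 < nu -> 0 < r ->
    let kappa := r ^ 2 / (4 * (nu + 1) * (nu + 2)) in
    let lambda := 0 in
    (forall x : R, Rabs x < r ->
       Rpower ((r ^ 2 - x ^ 2) / r ^ 2) kappa
         <= normBesselI (nu + 1) x / normBesselI nu x
         <= Rpower ((r ^ 2 - x ^ 2) / r ^ 2) lambda)
    /\ (forall k : R,
          (forall x : R, Rabs x < r ->
             Rpower ((r ^ 2 - x ^ 2) / r ^ 2) k
               <= normBesselI (nu + 1) x / normBesselI nu x) ->
          kappa <= k)
    /\ (forall l : R,
          (forall x : R, Rabs x < r ->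
             normBesselI (nu + 1) x / normBesselI nu x
               <= Rpower ((r ^ 2 - x ^ 2) / r ^ 2) l) ->
          l <= lambda))
  /\
  ((forall x : R, Rabs x < PI / 2 ->
      Rpower ((PI ^ 2 - 4 * x ^ 2) / PI ^ 2) (PI ^ 2 / 12)
        <= tanhc x
        <= Rpower ((PI ^ 2 - 4 * x ^ 2) / PI ^ 2) 0)
   /\ (forall k : R,
         (forall x : R, Rabs x < PI / 2 ->
            Rpower ((PI ^ 2 - 4 * x ^ 2) / PI ^ 2) k <= tanhc x) ->
         PI ^ 2 / 12 <= k)
   /\ (forall l : R,
         (forall x : R, Rabs x < PI / 2 ->
            tanhc x <= Rpower ((PI ^ 2 - 4 * x ^ 2) / PI ^ 2) l) ->
         l <= 0)).
Proof.
  split.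
  - intros nu r Hnu Hr kappa lambda. split; [|split].
    + intros x Hx. split; [now apply ratio_pow_lower|].
      unfold lambda, Rpower. rewrite Rmult_0_l, exp_0.
      now apply normBesselI_ratio_bounds.
    + intros k. now apply ratio_pow_lower_sharp.
    + intros l. now apply ratio_pow_upper_sharp.
  - assert (Hnu : -1 < - (1 / 2)) by lra.
    assert (Hr : 0 < PI / 2) by (generalize PI_RGT_0; lra).
    assert (Hkappa :
      PI ^ 2 / 12 = (PI / 2) ^ 2 / (4 * (- (1 / 2) + 1) * (- (1 / 2) + 2)))
      by field.
    assert (Hbase : forall x,
      (PI ^ 2 - 4 * x ^ 2) / PI ^ 2 = ((PI / 2) ^ 2 - x ^ 2) / (PI / 2) ^ 2)
      by (intros; field; apply PI_neq0).
    split; [|split].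
    + intros x Hx. rewrite tanhc_normBesselI. split.
      * rewrite Hbase, Hkappa. now apply ratio_pow_lower.
      * unfold Rpower. rewrite Rmult_0_l, exp_0.
        now apply normBesselI_ratio_bounds.
    + intros k Hk. rewrite Hkappa. apply ratio_pow_lower_sharp; try assumption.
      intros x Hx. rewrite <- Hbase, <- tanhc_normBesselI. now apply Hk.
    + intros l Hl. apply (ratio_pow_upper_sharp (- (1 / 2)) (PI / 2)); try assumption.
      intros x Hx. rewrite <- Hbase, <- tanhc_normBesselI. now apply Hl.
Qed.
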